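(* Let $f(\mathbf{x})=\log(\mathbf{1}_m^\top\exp(\mathbf{J}\mathbf{x}+\mathbf{b}))-\mathbf{c}^\top\mathbf{J}\mathbf{x}$ on $\mathbb{R}^n$, with $\mathbf{J}\in\mathbb{R}^{m\times n}$ and $\mathbf{b},\mathbf{c}\in\mathbb{R}^m$. Let $\mathbf{x}_i\in\mathbb{R}^n$, $\beta_i>0$ and $r\ge1$, and let $q_i,\mathbf{V}_i,\mathbf{T}_i$ be as defined in the context. Then the update $\Delta\mathbf{x}_i=-\mathbf{V}_i\mathbf{T}_i^{-1}\mathbf{V}_i^\top\nabla f(\mathbf{x}_i)$ satisfies $$\Delta\mathbf{x}_i\in\mathrm{row}(\mathbf{J})\qquad\text{and}\qquad \Delta\mathbf{x}_i^\top\nabla^2q_i(\mathbf{x}_i)\Delta\mathbf{x}_i=\Delta\mathbf{x}_i^\top\mathbf{V}_i\mathbf{T}_i\mathbf{V}_i^\top\Delta\mathbf{x}_i .$$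
   Context: Notation: $\mathbf{1}_m$ is the all-ones vector; $\exp$ is applied entrywise; $\mathrm{row}(\mathbf{J})\subseteq\mathbb{R}^n$ is the row space of $\mathbf{J}$. Put $\mathbf{p}_i=\exp(\mathbf{J}\mathbf{x}_i+\mathbf{b})/(\mathbf{1}_m^\top\exp(\mathbf{J}\mathbf{x}_i+\mathbf{b}))$ and $\mathbf{H}_i=\mathrm{diag}(\mathbf{p}_i)-\mathbf{p}_i\mathbf{p}_i^\top$, so $\nabla f(\mathbf{x}_i)=\mathbf{J}^\top(\mathbf{p}_i-\mathbf{c})$ and $\nabla^2f(\mathbf{x}_i)=\mathbf{J}^\top\mathbf{H}_i\mathbf{J}$. The shifted quadratic model is $$q_i(\mathbf{x})=\tfrac12(\mathbf{x}-\mathbf{x}_i)^\top\mathbf{J}^\top(\mathbf{H}_i+\beta_i\mathbf{I})\mathbf{J}(\mathbf{x}-\mathbf{x}_i)+\nabla f(\mathbf{x}_i)^\top(\mathbf{x}-\mathbf{x}_i),$$ so $\nabla^2q_i(\mathbf{x}_i)=\mathbf{J}^\top(\mathbf{H}_i+\beta_i\mathbf{I})\mathbf{J}$ and $\nabla q_i(\mathbf{x}_i)=\nabla f(\mathbf{x}_i)$. The Krylov subspace is $\mathcal{K}_r(\mathbf{A},\mathbf{g})=\mathrm{span}\{\mathbf{g},\mathbf{A}\mathbf{g},\dots,\mathbf{A}^{r-1}\mathbf{g}\}$. The columns of $\mathbf{V}_i$ form an orthonormal basis of $\mathcal{K}_r(\nabla^2q_i(\mathbf{x}_i),\nabla q_i(\mathbf{x}_i))$,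 and $\mathbf{T}_i=\mathbf{V}_i^\top\nabla^2q_i(\mathbf{x}_i)\mathbf{V}_i$, which is invertible. If $\nabla f(\mathbf{x}_i)=\mathbf{0}$ the subspace is trivial and $\Delta\mathbf{x}_i=\mathbf{0}$ (and $\mathbf{V}_i\mathbf{T}_i\mathbf{V}_i^\top$ is read as $\mathbf{0}$). *)

(* Defs.v *)
From HB Require Import structures.
From mathcomp Require Import all_boot all_order all_algebra.
From mathcomp Require Import all_classical all_reals all_analysis.

Set Implicit Arguments.
Unset Strict Implicit.
Unset Printing Implicit Defensive.
Import Order.TTheory GRing.Theory Num.Theory.
Import numFieldNormedType.Exports.
Local Open Scope ring_scope.

Definition dot (R : realType) (n : nat) (u v : 'cV[R]_n) : R :=
  (u^T *m v) 0 0.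

Definition ones (R : realType) (m : nat) : 'cV[R]_m := const_mx 1.

Definition expv (R : realType) (m : nat) (u : 'cV[R]_m) : 'cV[R]_m :=
  map_mx (@expR R) u.

Definition evec (R : realType) (n : nat) (i : 'I_n) : 'cV[R]_n :=
  delta_mx i 0.

Definition grad (R : realType) (n : nat) (f : 'cV[R]_n -> R) (x : 'cV[R]_n) :
  'cV[R]_n := \col_i 'D_(evec R i) f x.

Definition hess (R : realType) (n : nat) (f : 'cV[R]_n -> R) (x : 'cV[R]_n) :
  'M[R]_n := \matrix_(i, j) 'D_(evec R j) (fun y => 'D_(evec R i) f y) x.

Definition lse_obj (R : realType) (m n : nat) (J : 'M[R]_(m, n))
    (b c : 'cV[R]_m) (x : 'cV[R]_n) : R :=
  ln (dot (ones R m) (expv (J *m x + b))) - dot c (J *m x).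

Definition softmax (R : realType) (m n : nat) (J : 'M[R]_(m, n))
    (b : 'cV[R]_m) (x : 'cV[R]_n) : 'cV[R]_m :=
  (dot (ones R m) (expv (J *m x + b)))^-1 *: expv (J *m x + b).

Definition softmax_cov (R : realType) (m n : nat) (J : 'M[R]_(m, n))
    (b : 'cV[R]_m) (x : 'cV[R]_n) : 'M[R]_m :=
  let p := softmax J b x in diag_mx p^T - p *m p^T.

Definition qmodel (R : realType) (m n : nat) (J : 'M[R]_(m, n))
    (b c : 'cV[R]_m) (xi : 'cV[R]_n) (beta : R) (x : 'cV[R]_n) : R :=
  2^-1 * dot (x - xi)
           (J^T *m (softmax_cov J b xi + beta%:M) *m J *m (x - xi))
  + dot (grad (lse_obj J b c) xi) (x - xi).

(* Subspaces are row spaces, as in mxalgebra: row j of [krylov r A g] is the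
   transpose of A^j g, so the row space is span {g, A g, ..., A^(r-1) g}. *)
Definition krylov (R : realType) (n r : nat) (A : 'M[R]_n) (g : 'cV[R]_n) :
  'M[R]_(r, n) := \matrix_(j < r) (A ^+ j *m g)^T.

(* The columns of V are orthonormal and span the row space of W. The number k
   of columns is then \rank W, possibly 0. *)
Definition orthonormal_basis (R : realType) (n k l : nat) (V : 'M[R]_(n, k))
    (W : 'M[R]_(l, n)) : Prop :=
  V^T *m V = 1%:M /\ (V^T :=: W)%MS.

Definition proj_hess (R : realType) (n k : nat) (q : 'cV[R]_n -> R)
    (xi : 'cV[R]_n) (V : 'M[R]_(n, k)) : 'M[R]_k :=
  V^T *m hess q xi *m V.

(* [invmx] is the genuine inverse here: for q = qmodel J b c xi beta with
   0 < beta and V a basis of the Krylov space of q at xi (a subspace of the row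
   space of J), the matrix [proj_hess q xi V] is positive definite. If the
   Krylov space is trivial, V has no column and the step is 0. *)
Definition krylov_step (R : realType) (n k : nat) (f q : 'cV[R]_n -> R)
    (xi : 'cV[R]_n) (V : 'M[R]_(n, k)) : 'cV[R]_n :=
  - (V *m invmx (proj_hess q xi V) *m V^T *m grad f xi).

(* Main.v *)
Require Import Defs.
From HB Require Import structures.
From mathcomp Require Import all_boot all_order all_algebra.
From mathcomp Require Import all_classical all_reals all_analysis.

Set Implicit Arguments.
Unset Strict Implicit.
Unset Printing Implicit Defensive.
Import Order.TTheory GRing.Theory Num.Theory.
Import numFieldNormedType.Exports.
Local Open Scope ring_scope.

(** Both claims are linear algebra about the subspace spanned by the columns
    of V, once the gradient and the Hessian of q at xi are known.

    Membership in the row space of J: the step is V applied to a vector, so it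
    lies in the Krylov space generated by the gradient g and the Hessian A of q
    at xi. That space is spanned by g and by vectors in the image of A, so it
    suffices that g and the columns of A lie in the row space of J
    ([krylov_submx]). They do, as J^T is a left factor of both: the model is a
    quadratic polynomial with symmetric matrix A = J^T (H + beta I) J, whence
    its Hessian is A ([hess_quadratic]), and its gradient at xi is that of f
    ([grad_quadratic]), namely J^T (p - c) with p the softmax vector
    ([grad_lse_obj]).

    Equality of the quadratic forms: as V has orthonormal columns, V V^T is a
    projector that fixes the step, and V T V^T = (V V^T) A (V V^T).

    The gradients are computed from directional derivatives: when the
    derivative of f at x along every v is dot g v, the gradient is g
    ([gradE]). *)

(** * Directional derivatives of vector-valued maps *)

Lemma is_derive_mxP (R : realType) (W : normedModType R) (p s : nat)
    (M : W -> 'M[R]_(p, s)) (dM : 'M[R]_(p, s)) (x v : W) :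
  is_derive x v M dM <->
  forall i j, is_derive x v (fun y => M y i j) (dM i j).
Proof.
split=> [[dMx <-] i j|dMx].
  move/derivable_mxP: (dMx) => dMij.
  by apply: DeriveDef => //; rewrite derive_mx// mxE.
have dM' : derivable M x v by apply/derivable_mxP => i j; case: (dMx i j).
apply: DeriveDef => //; apply/matrixP => i j.
by rewrite derive_mx// mxE; case: (dMx i j).
Qed.

(** Restricting to the line t |-> t v + x turns a directional derivative into a
    derivative of a function of one real variable, where the one-dimensional
    chain rule applies. *)
Lemma is_derive_comp_real (R : realType) (W : normedModType R)
    (g : R -> R) (f : W -> R) (x v : W) (dg df : R) :
  is_derive (f x) 1 g dg -> is_derive x v f df ->
  is_derive x v (g \o f) (dg * df).
Proof.
have line (h : W -> R) a : is_derive x v h a <->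
    is_derive (0 : R) 1 (fun t : R => h (t *: v + x)) a.
  have E : 'D_1 (fun t : R => h (t *: v + x)) 0 = 'D_v h x.
    by rewrite /derive/=; under eq_fun do
      rewrite /= addr0 scale0r add0r [_%:A]mulr1.
  split=> -[dh <-]; split=> //; first exact: (derivable1P h x v).1.
  exact: (derivable1P h x v).2.
move=> dgx /line dfx; apply/(line (g \o f)).
apply: (@is_derive1_comp R g (fun t : R => f (t *: v + x))) => //.
by rewrite scale0r add0r.
Qed.

(** The difference quotient of an affine map is constant away from 0. *)
Lemma is_derive_affine (R : realType) (p s : nat) (A : 'M[R]_(p, s))
    (a : 'cV[R]_p) (x v : 'cV[R]_s) :
  is_derive x v (fun y => A *m y + a) (A *m v).
Proof.
have E : ((fun t : R => t^-1 *: (((fun y => A *m y + a) \o shift x) (t *: v)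
    - (A *m x + a))) @ 0^' --> A *m v)%classic.
  apply: cvg_near_cst; near=> t => /=.
  rewrite mulmxDr -(addrA (A *m _)) addrK -scalemxAr scalerA mulVf ?scale1r//.
  by near: t; exact: nbhs_dnbhs_neq.
apply: DeriveDef; first by apply/cvg_ex; exists (A *m v).
exact: cvg_lim E.
Unshelve. all: by end_near. Qed.

Lemma is_derive_dot (R : realType) (W : normedModType R) (p : nat)
    (f g : W -> 'cV[R]_p) (df dg : 'cV[R]_p) (x v : W) :
  is_derive x v f df -> is_derive x v g dg ->
  is_derive x v (fun y => dot (f y) (g y)) (dot df (g x) + dot (f x) dg).
Proof.
move=> /is_derive_mxP dfx /is_derive_mxP dgx.
have dotE (a b : 'cV[R]_p) : dot a b = \sum_i a i 0 * b i 0.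
  by rewrite /dot mxE; apply: eq_bigr => i _; rewrite mxE.
have := is_derive_sum (fun i => is_deriveM (dfx i 0) (dgx i 0)).
rewrite (_ : \sum_i _ = (fun y => dot (f y) (g y))); last first.
  by apply/funext => y; rewrite fct_sumE dotE.
move=> /is_derive_eq; apply.
rewrite !dotE -big_split/=; apply: eq_bigr => i _.
by rewrite [RHS]addrC [df i 0 * _]mulrC.
Qed.

(** [grad] only records the derivatives along the coordinate vectors; knowing
    the derivative along every direction as a scalar product identifies the
    gradient without any computation in coordinates. *)
Lemma gradE (R : realType) (n : nat) (f : 'cV[R]_n -> R) (x g : 'cV[R]_n) :
  (forall v, is_derive x v f (dot g v)) -> grad f x = g.
Proof.
move=> df; apply/matrixP => i j; rewrite ord1 mxE.
by rewrite derive_val /dot /evec -colE !mxE.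
Qed.

(** * The scalar product *)

Lemma dot_mulmx (R : realType) (p s : nat) (A : 'M[R]_(p, s))
    (u : 'cV[R]_p) (v : 'cV[R]_s) : dot u (A *m v) = dot (A^T *m u) v.
Proof. by rewrite /dot trmx_mul trmxK mulmxA. Qed.

Lemma dotC (R : realType) (p : nat) (u v : 'cV[R]_p) : dot u v = dot v u.
Proof. by rewrite /dot -[in LHS](trmxK v) -trmx_mul mxE. Qed.

Lemma dotDl (R : realType) (p : nat) (u w v : 'cV[R]_p) :
  dot (u + w) v = dot u v + dot w v.
Proof. by rewrite /dot linearD mulmxDl mxE. Qed.

Lemma dotZl (R : realType) (p : nat) (k : R) (u v : 'cV[R]_p) :
  dot (k *: u) v = k * dot u v.
Proof. by rewrite /dot linearZ -scalemxAl mxE. Qed.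

Lemma dot0l (R : realType) (p : nat) (v : 'cV[R]_p) : dot 0 v = 0.
Proof. by rewrite /dot trmx0 mul0mx mxE. Qed.

(** * Gradient of the log-sum-exp objective *)

Lemma dot_ones_expv (R : realType) (m : nat) (y : 'cV[R]_m) :
  dot (ones R m) (expv y) = \sum_i expR (y i 0).
Proof. by rewrite /dot mxE; apply: eq_bigr => i _; rewrite !mxE mul1r. Qed.

Lemma dot_ones_expv_gt0 (R : realType) (m : nat) (y : 'cV[R]_m) :
  (0 < m)%N -> 0 < dot (ones R m) (expv y).
Proof.
case: m y => // m y _; rewrite dot_ones_expv big_ord_recl.
by rewrite ltr_pwDl ?expR_gt0// sumr_ge0// => i _; exact: expR_ge0.
Qed.

Lemma is_derive_sum_expv (R : realType) (W : normedModType R) (m : nat)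
    (u : W -> 'cV[R]_m) (du : 'cV[R]_m) (x v : W) :
  is_derive x v u du ->
  is_derive x v (fun y => dot (ones R m) (expv (u y))) (dot (expv (u x)) du).
Proof.
move=> /is_derive_mxP dux.
have := is_derive_sum (fun i =>
  is_derive_comp_real (is_derive_expR (u x i 0)) (dux i 0)).
rewrite (_ : \sum_i _ = (fun y => dot (ones R m) (expv (u y)))); last first.
  by apply/funext => y; rewrite fct_sumE dot_ones_expv.
move=> /is_derive_eq; apply.
by rewrite /dot mxE; apply: eq_bigr => i _; rewrite !mxE.
Qed.

(** By the chain rule the derivative along v is the scalar product of p - c
    with J v, the factor 1 / sum exp from the logarithm being the normalisation
    of the softmax; J^T appears when J is moved to the other side. *)
Lemma grad_lse_obj (R : realType) (m n : nat) (J : 'M[R]_(m, n))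
    (b c : 'cV[R]_m) (x : 'cV[R]_n) : (0 < m)%N ->
  grad (lse_obj J b c) x = J^T *m (softmax J b x - c).
Proof.
move=> m0; apply: gradE => v; rewrite /lse_obj.
have dexp := is_derive_sum_expv (is_derive_affine J b x v).
have dlin : is_derive x v (fun y => dot c (J *m y)) (dot c (J *m v)).
  have -> : (fun y => dot c (J *m y)) =
      (fun y => dot (cst c y) (J *m y + 0)) by apply/funext=> y; rewrite addr0.
  apply: is_derive_eq.
    exact: is_derive_dot (is_derive_cst _ _ _) (is_derive_affine J 0 x v).
  by rewrite dot0l add0r.
have dln := is_derive1_ln (dot_ones_expv_gt0 (J *m x + b) m0).
have dlog := is_derive_comp_real
  (f := fun y => dot (ones R m) (expv (J *m y + b))) dln dexp.
move/is_derive_eq: (is_deriveB dlog dlin); apply.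
by rewrite -dot_mulmx dotDl /softmax dotZl -[- c]scaleN1r dotZl mulN1r.
Qed.

(** * Quadratic polynomials *)

(** Both terms of the product rule contribute A (x - a) since A is symmetric,
    which cancels the factor 1/2. *)
Lemma grad_quadratic (R : realType) (n : nat) (A : 'M[R]_n)
    (a g x : 'cV[R]_n) : A^T = A ->
  grad (fun y => 2^-1 * dot (y - a) (A *m (y - a)) + dot g (y - a)) x =
  A *m (x - a) + g.
Proof.
move=> symA; apply: gradE => v.
have dsub : is_derive x v (fun y => y - a) v.
  rewrite -[X in is_derive _ _ _ X]mul1mx.
  under eq_fun do rewrite -[X in X - a]mul1mx.
  exact: is_derive_affine.
have dA : is_derive x v (fun y => A *m (y - a)) (A *m v).
  under eq_fun do rewrite mulmxBr.
  exact: is_derive_affine.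
have dquad := is_deriveZ 2^-1 (is_derive_dot dsub dA).
have dlin := is_derive_dot (is_derive_cst g x v) dsub.
move/is_derive_eq: (is_deriveD dquad dlin); apply.
rewrite dot0l add0r (dotC v) (dot_mulmx A) symA dotDl -mulr2n.
rewrite -[dot _ _ *+ 2]mulr_natl.
by congr (_ + _); apply: mulKf; rewrite pnatr_eq0.
Qed.

(** The entries of the Hessian are derivatives of the components of the
    gradient, which is affine with linear part A. *)
Lemma hess_quadratic (R : realType) (n : nat) (A : 'M[R]_n)
    (a g x : 'cV[R]_n) : A^T = A ->
  hess (fun y => 2^-1 * dot (y - a) (A *m (y - a)) + dot g (y - a)) x = A.
Proof.
move=> symA; apply/matrixP => i j; rewrite mxE.
set quad := (fun y => _ + _).
have -> : (fun y => 'D_(evec R i) quad y) =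
    (fun y => (A *m y + (g - A *m a)) i 0).
  apply/funext => y; have /matrixP/(_ i 0) := grad_quadratic a g y symA.
  by rewrite mxE => ->; rewrite mulmxBr addrAC addrA.
have /is_derive_mxP/(_ i 0) dA :=
  is_derive_affine A (g - A *m a) x (evec R j).
by rewrite derive_val /evec -colE mxE.
Qed.

(** * Krylov spaces and the step *)

Lemma trmx_softmax_cov (R : realType) (m n : nat) (J : 'M[R]_(m, n))
    (b : 'cV[R]_m) (x : 'cV[R]_n) :
  (softmax_cov J b x)^T = softmax_cov J b x.
Proof.
by rewrite /softmax_cov linearB/= tr_diag_mx trmx_mul trmxK.
Qed.

(** The vectors A^(j+1) g are in the image of A, so the spanning vectors with
    positive index are covered by the condition on A and only g itself needs
    the condition on g. *)
Lemma krylov_submx (R : realType) (m n r : nat) (J : 'M[R]_(m, n))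
    (A : 'M[R]_n) (g : 'cV[R]_n) :
  (A^T <= J)%MS -> (g^T <= J)%MS -> (krylov r A g <= J)%MS.
Proof.
move=> AJ gJ; apply/row_subP => j; rewrite rowK.
case: (nat_of_ord j) => [|k]; first by rewrite expr0 mul1mx.
by rewrite exprS -mulmxE -mulmxA trmx_mul (submx_trans (submxMl _ _)).
Qed.

Theorem lemma3p2 (R : realType) (m n : nat) (J : 'M[R]_(m, n))
    (b c : 'cV[R]_m) (xi : 'cV[R]_n) (beta : R) (r k : nat)
    (V : 'M[R]_(n, k))
    (f := lse_obj J b c)
    (q := qmodel J b c xi beta)
    (T := proj_hess q xi V)
    (dx := krylov_step f q xi V) :
  (0 < m)%N ->
  0 < beta ->
  (1 <= r)%N ->
  orthonormal_basis V (krylov r (hess q xi) (grad q xi)) ->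
  (dx^T <= J)%MS /\
  dx^T *m hess q xi *m dx = dx^T *m V *m T *m V^T *m dx.
Proof.
move=> m0 _ _ [orthoV spanV].
have dxV : dx = V *m (- (invmx T *m V^T *m grad f xi)).
  by rewrite mulmxN !mulmxA.
split.
  set M := softmax_cov J b xi + beta%:M.
  have symA : (J^T *m M *m J)^T = J^T *m M *m J.
    rewrite !trmx_mul trmxK mulmxA; congr (_ *m _ *m _).
    by rewrite linearD/= trmx_softmax_cov tr_scalar_mx.
  rewrite dxV trmx_mul (submx_trans (submxMl _ _))// spanV.
  apply: krylov_submx.
    by rewrite hess_quadratic// symA submxMl.
  rewrite grad_quadratic// subrr mulmx0 add0r grad_lse_obj//.
  by rewrite trmx_mul trmxK submxMl.
(* V^T V = 1 makes V V^T the identity on the range of V. *)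
have projdx : V *m (V^T *m dx) = dx by rewrite dxV (mulmxA V^T) orthoV mul1mx.
have projdxT : dx^T *m V *m V^T = dx^T.
  by rewrite -[in RHS]projdx !trmx_mul trmxK.
have -> : dx^T *m V *m T *m V^T *m dx =
    dx^T *m V *m V^T *m hess q xi *m (V *m (V^T *m dx)).
  by rewrite /T /proj_hess !mulmxA.
by rewrite projdxT projdx.
Qed.
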